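(* Let $(X,d)$ be a complete metric space with $|X|\geq 3$, and let $T\colon X\to X$ be a mapping such that: (i) $T$ does not possess periodic points of prime period $2$; (ii) $T$ is a generalized Kannan type mapping on $X$. Then $T$ has a fixed point, and the number of fixed points of $T$ is at most two.
   Context: For a metric space $(X,d)$ with $|X|\geq 3$, a mapping $T\colon X\to X$ is called a generalized Kannan type mapping on $X$ if there exists $\lambda\in[0,\frac{2}{3})$ such that the inequality $$d(Tx,Ty)+d(Ty,Tz)+d(Tx,Tz)\leq \lambda\,(d(x,Tx)+d(y,Ty)+d(z,Tz))$$ holds for all three pairwise distinct points $x,y,z\in X$. A point $x\in X$ is a periodic point of prime period $2$ of $T$ if $T(T(x))=x$ and $Tx\neq x$. *)

(* Defs.v *)
From mathcomp Require Import all_boot all_order all_algebra.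
From mathcomp Require Import all_classical all_reals all_analysis.

Set Implicit Arguments.
Unset Strict Implicit.
Unset Printing Implicit Defensive.

Import Order.TTheory GRing.Theory Num.Theory.

Local Open Scope classical_set_scope.
Local Open Scope ring_scope.

(* The library's completeType bundles a base point; this is its axiom
   [cauchy_cvg], stated for a space without one and for sequences, as is usual
   for metric spaces. *)
Definition complete_metric (R : realType) (X : metricType R) : Prop :=
  forall u : nat -> X, cauchy (u @ \oo) -> exists l : X, u @ \oo --> l.

Definition generalized_kannan (R : realType) (X : metricType R) (T : X -> X)
    : Prop :=
  exists lambda : R, [/\ 0 <= lambda, lambda < 2 / 3 &
    forall x y z : X, x <> y -> y <> z -> x <> z ->
      mdist (T x) (T y) + mdist (T y) (T z) + mdist (T x) (T z)
      <= lambda * (mdist x (T x) + mdist y (T y) + mdist z (T z))].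

Definition periodic_prime2 (X : Type) (T : X -> X) (x : X) : Prop :=
  T (T x) = x /\ T x <> x.

Definition fixed_points (X : Type) (T : X -> X) : set X := [set x | T x = x].

(* Main.v *)
Require Import Defs.
From mathcomp Require Import all_boot all_order all_algebra.
From mathcomp Require Import all_classical all_reals all_analysis.
From mathcomp Require Import ring lra.

Import Order.TTheory GRing.Theory Num.Theory.

Local Open Scope classical_set_scope.
Local Open Scope ring_scope.
Local Open Scope card_scope.

(** Three distinct fixed points would make the right-hand side of the
    generalized Kannan inequality zero and the left-hand side positive, so there
    are at most two.

    For existence, suppose that T has no fixed point. Then, since T has no point
    of prime period 2 either, x, T x and T (T x) are pairwise distinct for every
    x, and the inequality applies to any three consecutive points of an orbit.
    Let a_n be the n-th step length of the orbit. Bounding the third side of the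
    image triangle below by a_(n+2) - a_(n+1) gives
    (2 - lambda) a_(n+2) <= lambda (a_n + a_(n+1))
    ([kannan_orbit_step]). As lambda < 2/3, the coefficient
    lambda / (2 - lambda) is less than 1/2, and the potential
    b_n = a_n + 2 a_(n+1) decreases geometrically; it dominates the steps, so
    the orbit is Cauchy ([cauchy_geometric_majorant], [kannan_orbit_cauchy]).

    Let p be the limit of the orbit x_n. Among three consecutive orbit points at
    most one is p, so p, x_m, x_(m+1) are pairwise distinct for arbitrarily
    large m ([orbit_avoids_point]). The inequality for this triple becomes 2 d(p, T p) <= lambda d(p, T p) in the
    limit, which forces T p = p ([kannan_limit_fixed]). *)

(** A telescoping argument with no explicit series: (1 - q) d(u_n, u_m) <= b_n
    for m >= n, because b_n pays for the first step and leaves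
    q b_n >= b_(n+1) for the remaining ones. *)
Lemma cauchy_geometric_majorant (R : realType) (X : metricType R)
    (u : nat -> X) (b : nat -> R) (q : R) :
  0 <= q -> q < 1 ->
  (forall n, mdist (u n) (u n.+1) <= b n) ->
  (forall n, b n.+1 <= q * b n) ->
  cauchy (u @ \oo).
Proof.
move=> q0 q1 ub bq.
have b_ge0 n : 0 <= b n by exact: le_trans (mdist_ge0 _ _) (ub n).
have tail k : forall n, (1 - q) * mdist (u n) (u (n + k)%N) <= b n.
  elim: k => [|k IHk] n; first by rewrite addn0 mdistxx mulr0.
  have := metric_triangle (u n) (u n.+1) (u (n + k.+1)%N).
  have := IHk n.+1; rewrite addSnnS => tail_n1 triangle_n.
  have r0 : 0 <= 1 - q by rewrite subr_ge0 ltW.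
  have := ler_wpM2l r0 triangle_n; rewrite mulrDr.
  have := ler_wpM2l r0 (ub n).
  have := bq n; lra.
have bX n : b n <= b 0%N * q ^+ n.
  elim: n => [|n IHn]; first by rewrite expr0 mulr1.
  apply: le_trans (bq n) _.
  by rewrite exprS mulrCA ler_wpM2l.
have bX0 : (fun n => b 0%N * q ^+ n : R^o) @ \oo --> (0 : R^o).
  rewrite -[X in _ --> X](mulr0 (b 0%N)).
  by apply: cvgMr; apply: cvg_expr; rewrite ger0_norm.
apply: cauchy_exP => e e0.
have [|N _ small] := (cvgrPdist_lt _ _).1 bX0 ((1 - q) * e).
  by rewrite mulr_gt0// subr_gt0.
exists (u N); exists N => // n /= Nn.
rewrite ballEmdist/= -(@ltr_pM2l _ (1 - q)) ?subr_gt0//.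
have := tail (n - N)%N N; rewrite subnKC// => /le_lt_trans; apply.
apply: le_lt_trans (bX N) _.
have := small N (leqnn N).
by rewrite sub0r normrN ger0_norm// mulr_ge0// exprn_ge0.
Qed.

Section FixedPointFree.
Variables (R : realType) (X : metricType R) (T : X -> X) (lambda : R).
Hypotheses (lambda_ge0 : 0 <= lambda) (lambda_lt : lambda < 2 / 3).
Hypothesis kannanT : forall x y z : X, x <> y -> y <> z -> x <> z ->
  mdist (T x) (T y) + mdist (T y) (T z) + mdist (T x) (T z)
  <= lambda * (mdist x (T x) + mdist y (T y) + mdist z (T z)).
Hypotheses (fixfree : forall x, T x <> x) (perfree : forall x, T (T x) <> x).

Lemma kannan_orbit_step x :
  (2 - lambda) * mdist (T (T x)) (T (T (T x)))
  <= lambda * (mdist x (T x) + mdist (T x) (T (T x))).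
Proof.
have := @kannanT x (T x) (T (T x)).
move=> /(_ (nesym (fixfree _)) (nesym (fixfree _)) (nesym (perfree _))).
have := metric_triangle (T (T x)) (T x) (T (T (T x))).
rewrite [X in _ <= X + _]metric_sym; lra.
Qed.

Lemma kannan_orbit_cauchy x : cauchy ((fun n => iter n T x) @ \oo).
Proof.
pose a n := mdist (iter n T x) (iter n.+1 T x).
have a_ge0 n : 0 <= a n by exact: mdist_ge0.
have [l0 l1] : 0 <= lambda /\ lambda < 2 / 3 by [].
have l2 : 0 < 2 - lambda by lra.
(* With beta = lambda / (2 - lambda), the ratio below is beta + 1/2. It bounds
   both quotients of coefficients in b_(n+1) <= 2 beta a_n + (1 + 2 beta)
   a_(n+1), namely 2 beta and (1 + 2 beta) / 2. *)
pose q := (2 + lambda) / (2 * (2 - lambda)).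
apply: (@cauchy_geometric_majorant _ _ _ (fun n => a n + 2 * a n.+1) q).
- by apply: divr_ge0; lra.
- by rewrite ltr_pdivrMr; lra.
- by move=> n; have := a_ge0 n.+1; rewrite /a; lra.
- move=> n; rewrite -(@ler_pM2l _ (2 - lambda))//.
  have -> : (2 - lambda) * (q * (a n + 2 * a n.+1)) =
      (2 + lambda) / 2 * (a n + 2 * a n.+1).
    by rewrite /q; field; rewrite gt_eqF.
  have step : (2 - lambda) * a n.+2 <= lambda * (a n + a n.+1).
    exact: kannan_orbit_step.
  have : 0 <= (2 / 3 - lambda) * a n by rewrite mulr_ge0// subr_ge0 ltW.
  lra.
Qed.

(** The orbit may pass through its limit p, where the inequality cannot be
    applied; it then stays away from p for the next two steps. *)
Lemma orbit_avoids_point p x N :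
  exists m, [/\ (N <= m)%N, p <> iter m T x & p <> iter m.+1 T x].
Proof.
have [pN|pN] := pselect (p = iter N T x).
  exists N.+1; split=> //; first by rewrite pN; exact: nesym (fixfree _).
  by rewrite pN; exact: nesym (perfree _).
have [pN1|pN1] := pselect (p = iter N.+1 T x); last by exists N.
exists N.+2; split=> //; first by rewrite -addn2 leq_addr.
  by rewrite pN1; exact: nesym (fixfree _).
by rewrite pN1; exact: nesym (perfree _).
Qed.

(** A quantitative form of passing to the limit in the inequality for
    p, x_m, x_(m+1): since T need not be continuous at p, the distances from T p
    to x_(m+1) and x_(m+2) are compared with d(p, T p) by the triangle
    inequality. *)
Lemma kannan_limit_fixed x p : (fun n => iter n T x) @ \oo --> p -> T p = p.
Proof.
move=> xp; apply: contrapT => Tp.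
have [l0 l1] : 0 <= lambda /\ lambda < 2 / 3 by [].
have D_gt0 : 0 < mdist p (T p) by rewrite mdist_gt0; apply/eqP/nesym.
(* The limit of the inequality has slack (2 - lambda) d > 4/3 d, while the
   distances replaced by e contribute at most (2 + 4 lambda) e < 5 e. *)
pose e := mdist p (T p) / 10.
have e_gt0 : 0 < e by rewrite divr_gt0.
have [N _ near_p] := metricType_numDomainType.cvgr_dist_lt xp e_gt0.
have [m [Nm pm pm1]] := orbit_avoids_point p x N.
have close k : mdist p (iter (m + k) T x) < e.
  by apply: near_p => /=; exact: leq_trans Nm (leq_addr _ _).
have m0 := close 0%N; have m1 := close 1%N; have m2 := close 2%N.
rewrite addn0 in m0; rewrite addn1/= in m1; rewrite addn2/= in m2.
move: pm1 m0 m1 m2; rewrite /=; move: (iter m T x) pm => y py pTy m0 m1 m2.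
have ineq := kannanT _ _ _ py (nesym (fixfree y)) pTy.
have t0 := metric_triangle y p (T y).
have t1 := metric_triangle (T y) p (T (T y)).
have t2 := metric_triangle p (T y) (T p).
have t3 := metric_triangle p (T (T y)) (T p).
rewrite (metric_sym y p) in t0; rewrite (metric_sym (T y) p) in t1.
rewrite (metric_sym (T y) (T p)) in t2.
rewrite (metric_sym (T (T y)) (T p)) in t3.
have := mdist_ge0 (T y) (T (T y)).
have : lambda * (mdist p (T p) + mdist y (T y) + mdist (T y) (T (T y))) <=
    2 / 3 * (mdist p (T p) + 4 * e).
  apply: ler_pM => //; first by rewrite !addr_ge0// mdist_ge0.
    exact: ltW.
  by lra.
rewrite /e in m0 m1 m2 *; lra.
Qed.

End FixedPointFree.

Lemma kannan_fixed_points_card (R : realType) (X : metricType R) (T : X -> X) :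
  generalized_kannan T -> fixed_points T #<= `I_2.
Proof.
move=> [lambda [_ _ kannanT]].
have fix3 x y z : T x = x -> T y = y -> T z = z ->
    x <> y -> y <> z -> x <> z -> False.
  move=> Tx Ty Tz xy yz xz; have := kannanT _ _ _ xy yz xz.
  rewrite Tx Ty Tz !mdistxx !addr0 mulr0.
  have : 0 < mdist x y by rewrite mdist_gt0; exact/eqP.
  have := mdist_ge0 y z; have := mdist_ge0 x z; lra.
(* All fixed points lie in a set {p, r}, with p = r when there is only one. *)
have cover p r : fixed_points T `<=` [set x | x = p \/ x = r] ->
    fixed_points T #<= `I_2.
  move=> sub; apply: card_le_trans (card_image_le
    (fun i : nat => if i == 0%N then p else r) `I_2).
  by apply: subset_card_le => x /sub[->|->]; [exists 0%N|exists 1%N].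
have [[p Tp]|/set0P/negP/negPn/eqP ->] := pselect (fixed_points T !=set0);
  last by rewrite card_ge0.
have [[r [Tr rp]]|only] := pselect (exists r, T r = r /\ r <> p).
  apply: (cover p r) => x Tx /=.
  apply: contrapT => /not_orP[xp xr].
  exact: (fix3 p r x Tp Tr Tx (nesym rp) (nesym xr) (nesym xp)).
apply: (cover p p) => x Tx; left.
by apply: contrapT => xp; apply: only; exists x.
Qed.

Theorem theorem3p2 (R : realType) (X : metricType R)
    (cX : complete_metric X) (X3 : `I_3 #<= [set: X])
    (T : X -> X)
    (noper2 : ~ exists x : X, periodic_prime2 T x)
    (kannan : generalized_kannan T) :
  fixed_points T !=set0 /\ fixed_points T #<= `I_2.
Proof.
split; last exact: kannan_fixed_points_card.
have [x0 _] : [set: X] !=set0.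
  apply/set0P/eqP => X0; move: X3; rewrite X0 card_le0 => /eqP I0.
  by have : `I_3 0%N by []; rewrite I0.
(* The inequality says nothing about pairs of points, so the fixed-point-free
   assumption is what makes it available along an orbit. *)
apply: contrapT => nofix.
have fixfree x : T x <> x by move=> Tx; apply: nofix; exists x.
have perfree x : T (T x) <> x by move=> TTx; apply: noper2; exists x.
have [lambda [l0 l1 kannanT]] := kannan.
have [p xp] := cX _ (kannan_orbit_cauchy _ _ _ _ l0 l1 kannanT fixfree perfree x0).
exact: fixfree (kannan_limit_fixed _ _ _ _ l0 l1 kannanT fixfree perfree _ _ xp).
Qed.
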